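(* Let $A$ be a connected noetherian graded algebra, and $M$ a decomposable bi-Koszul module over $A$, with minimal graded free resolution $\mathcal{Q}$. Then $\mathcal{Q}$ can be decomposed into a direct sum of two pure resolutions. Moreover, there exists a short exact sequence $0\to M'\to M\to M''\to 0$ of graded $A$-modules such that both $M'$ and $M''$ are $\delta$-Koszul modules.
   Context: $A=k\oplus A_1\oplus A_2\oplus\cdots$ is an associative graded algebra over a field, generated in degrees $0$ and $1$ with $A_1$ finite-dimensional; connected means that $k=A_0$ is itself a field. $A$ is noetherian. Morphisms of graded left modules have degree zero. ''Generated in degrees $S$'' means generated by homogeneous elements with degrees in $S$. Fix an integer $d\ge2$. Let $\Delta(3m)=\{2md\}$, $\Delta(3m+1)=\{2md+1\}$, $\Delta(3m+2)=\{2md+d,\,2md+d+1\}$ for $m\ge0$. $A$ is a bi-Koszul algebra if the $n$-th term of a minimal graded projective resolution of the trivial left module $k=A/A_{\ge1}$ is generated in degrees $\Delta(n)$ for all $n\ge0$. A bi-Koszul module (a notion defined over a bi-Koszul algebra $A$) is a graded left $A$-module $M$ such that the $n$-th term of a minimal graded projective resolution of $M$ is generated in degrees $\Delta(n)$ for all $n\ge 0$. A resolution is pure if each of its projective terms is generated in a single degree. A graded module is $\delta$-Koszul if there is a function $\delta:\mathbb{N}\to\mathbb{N}$ such that, for every $m$, the $m$-th term of its minimal graded projective resolution is generated in degree $\delta(m)$. Matrices. Let $M,N$ be finitely generated graded free left $A$-modules with homogeneous bases, written as columns $\zeta=(x_1,\dots,x_s)^T$ and $\xi=(y_1,\dots,y_t)^T$,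 ordered so that degrees are non-decreasing. A matrix $F\in\mathbb{M}_{s\times t}(A)$ is the matrix representation of a degree-zero map $f:M\to N$ if $f(\zeta)=F\xi$, i.e. $f(x_i)=\sum_j a_{ij}y_j$. A block matrix $F=\begin{pmatrix} F' & 0 \\ U & F'' \end{pmatrix}$ with $F',F''$ nonzero is admissible if for every row vector $X''$ over $A$ (of length the number of rows of $U$) there is a row vector $X'$ over $A$ with $X''U=X'F'$. Decomposable. Let $M$ be a bi-Koszul module with (finitely generated) minimal free resolution $\mathcal{Q}:\cdots\to Q_2\xrightarrow{\partial_2}Q_1\xrightarrow{\partial_1}Q_0\to M\to0$, where $Q_{3n+2}$ is free with $p_{3n+2}$ basis elements of degree $2nd+d$ and $q_{3n+2}$ basis elements of degree $2nd+d+1$. $M$ is decomposable if, for each $m\ge1$ (with $Q_m\neq0$), the matrix representation $F_m$ of $\partial_m$ has the form $F_m=\begin{pmatrix} F_m' & 0 \\ U_m & F_m'' \end{pmatrix}$, where (1) $F_m$ is admissible (if the resolution ends at $Q_m$ with $m\not\equiv2 \pmod 3$, the form $F_m=(F_m'\ \,0)$ is also permitted); (2) the product $F_{m+1}F_m$ is consistent with block multiplication (the blocks of the columns of $F_{m+1}$ have the same sizes as the blocks of the rows of $F_m$); (3) the number of rows of $F'_{3n+2}$ equals $p_{3n+2}$. *)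

(* Defs.v *)
From HB Require Import structures.
From mathcomp Require Import all_boot all_order all_algebra.

Set Implicit Arguments.
Unset Strict Implicit.
Unset Printing Implicit Defensive.

Import GRing.Theory.
Local Open Scope ring_scope.

(* V is the (internal) direct sum of its subgroups G i.                       *)
Definition direct_sum_decomposition (I : eqType) (V : zmodType)
    (G : I -> V -> Prop) : Prop :=
  [/\ forall i, G i 0,
      forall i x y, G i x -> G i y -> G i (x - y),
      forall x, exists (s : seq I) (u : I -> V),
        [/\ uniq s, forall i, G i (u i) & x = \sum_(i <- s) u i]
    & forall (s : seq I) (u : I -> V),
        uniq s -> (forall i, G i (u i)) -> \sum_(i <- s) u i = 0 ->
        forall i, i \in s -> u i = 0].

Record graded_algebra_axioms (k : fieldType) (A : algType k)
    (G : nat -> A -> Prop) : Prop := GradedAlgebraAxioms {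
  ga_direct : direct_sum_decomposition G;
  ga_scale : forall i (c : k) x, G i x -> G i (c *: x);
  ga_one : G 0 1;
  ga_mul : forall i j x y, G i x -> G j y -> G (i + j)%N (x * y);
  ga_generated : forall S : A -> Prop,
    (forall x, G 0 x -> S x) -> (forall x, G 1 x -> S x) ->
    (forall x y, S x -> S y -> S (x + y)) ->
    (forall x y, S x -> S y -> S (x * y)) ->
    forall x, S x;
  ga_findim1 : exists (n : nat) (e : 'I_n -> A), (forall i, G 1 (e i)) /\
    forall x, G 1 x -> exists c : 'I_n -> k, x = \sum_i c i *: e i }.

Structure gradedAlgebra (k : fieldType) := GradedAlgebra {
  ga_sort :> algType k;
  ga_deg : nat -> ga_sort -> Prop;
  ga_axioms : graded_algebra_axioms ga_deg }.

Section GradedModules.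

Context (k : fieldType) (A : gradedAlgebra k).

Definition connected : Prop :=
  forall a : A, ga_deg 0 a <-> exists c : k, a = c%:A.

Definition left_ideal (I : A -> Prop) : Prop :=
  [/\ I 0, forall x y, I x -> I y -> I (x + y)
    & forall a x, I x -> I (a * x)].

Definition right_ideal (I : A -> Prop) : Prop :=
  [/\ I 0, forall x y, I x -> I y -> I (x + y)
    & forall a x, I x -> I (x * a)].

Definition left_noetherian : Prop := forall I, left_ideal I ->
  exists (n : nat) (g : 'I_n -> A), forall x,
    I x <-> exists c : 'I_n -> A, x = \sum_i c i * g i.

Definition right_noetherian : Prop := forall I, right_ideal I ->
  exists (n : nat) (g : 'I_n -> A), forall x,
    I x <-> exists c : 'I_n -> A, x = \sum_i g i * c i.

Definition noetherian : Prop := left_noetherian /\ right_noetherian.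

(* The ideal A_{>=1}. *)
Definition irrelevant (a : A) : Prop :=
  exists (s : seq nat) (u : nat -> A),
    [/\ all (fun i => 0 < i)%N s, forall i, ga_deg i (u i)
      & a = \sum_(i <- s) u i].

Record graded_module_axioms (M : lmodType A) (G : int -> M -> Prop) : Prop :=
  GradedModuleAxioms {
    gm_direct : direct_sum_decomposition G;
    gm_scale : forall (i : nat) (j : int) (a : A) x,
      ga_deg i a -> G j x -> G (i%:Z + j) (a *: x) }.

Structure gradedModule := GradedModule {
  gm_sort :> lmodType A;
  gm_deg : int -> gm_sort -> Prop;
  gm_axioms : graded_module_axioms gm_deg }.

Definition degree_zero (M N : gradedModule) (f : M -> N) : Prop :=
  forall i x, gm_deg i x -> gm_deg i (f x).

Definition surjective (M N : gradedModule) (f : M -> N) : Prop :=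
  forall y, exists x, f x = y.

Definition is_zero (M : gradedModule) : Prop := forall x : M, x = 0.

Definition generated_in (S : seq int) (M : gradedModule) : Prop :=
  forall x : M, exists (n : nat) (a : 'I_n -> A) (g : 'I_n -> M),
    (forall i, exists2 j, j \in S & gm_deg j (g i)) /\
    x = \sum_i a i *: g i.

(* The submodule A_{>=1} M of M. *)
Definition irrelevant_mul (M : gradedModule) (x : M) : Prop :=
  exists (n : nat) (a : 'I_n -> A) (g : 'I_n -> M),
    (forall i, irrelevant (a i)) /\ x = \sum_i a i *: g i.

Definition graded_projective (P : gradedModule) : Prop :=
  forall (N N' : gradedModule) (g : {linear N -> N'}) (h : {linear P -> N'}),
    degree_zero g -> degree_zero h -> surjective g ->
    exists h' : {linear P -> N}, degree_zero h' /\ forall x, g (h' x) = h x.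

(* A finite homogeneous basis e (with e i of degree dg i), ordered so that    *)
(* degrees are non-decreasing.                                                *)
Definition homogeneous_basis (M : gradedModule) (n : nat) (dg : 'I_n -> int)
    (e : 'I_n -> M) : Prop :=
  [/\ forall i, gm_deg (dg i) (e i),
      forall i j : 'I_n, (i <= j)%N -> dg i <= dg j
    & forall x : M, exists! c : 'rV[A]_n, x = \sum_i c 0 i *: e i].

Definition fg_graded_free (M : gradedModule) : Prop :=
  exists (n : nat) (dg : 'I_n -> int) (e : 'I_n -> M), homogeneous_basis dg e.

(* Sequences ... -> C 2 -> C 1 -> C 0, with cdiff C n : C n.+1 -> C n, i.e.   *)
(* cdiff C n is the differential usually written with the index n + 1.        *)
Structure gradedSequence := GradedSequence {
  cterm :> nat -> gradedModule;
  cdiff : forall n, {linear cterm n.+1 -> cterm n} }.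

Definition resolution (Q : gradedSequence) (M : gradedModule) : Prop :=
  (forall n, degree_zero (cdiff Q n)) /\
  exists eps : {linear Q 0%N -> M},
    [/\ degree_zero eps, surjective eps,
        forall x, eps x = 0 <-> exists y, x = cdiff Q 0 y
      & forall n x, cdiff Q n x = 0 <-> exists y, x = cdiff Q n.+1 y].

Definition minimal (Q : gradedSequence) : Prop :=
  forall n x, irrelevant_mul (cdiff Q n x).

Definition projective_resolution (Q : gradedSequence) (M : gradedModule) :=
  resolution Q M /\ forall n, graded_projective (Q n).

Definition minimal_projective_resolution (Q : gradedSequence)
    (M : gradedModule) : Prop :=
  projective_resolution Q M /\ minimal Q.

Definition minimal_free_resolution (Q : gradedSequence)
    (M : gradedModule) : Prop :=
  [/\ resolution Q M, forall n, fg_graded_free (Q n) & minimal Q].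

Definition pure (Q : gradedSequence) : Prop :=
  forall n, exists j : int, generated_in [:: j] (Q n).

Definition delta_koszul (M : gradedModule) : Prop :=
  exists (delta : nat -> nat) (P : gradedSequence),
    minimal_projective_resolution P M /\
    forall m, generated_in [:: (delta m)%:Z] (P m).

Definition Delta (d n : nat) : seq int :=
  let m := (n %/ 3)%N in
  match (n %% 3)%N with
  | 0 => [:: (2 * m * d)%N%:Z]
  | 1 => [:: (2 * m * d + 1)%N%:Z]
  | _ => [:: (2 * m * d + d)%N%:Z; (2 * m * d + d + 1)%N%:Z]
  end.

Definition has_Delta_resolution (d : nat) (M : gradedModule) : Prop :=
  exists P : gradedSequence, minimal_projective_resolution P M /\
    forall n, generated_in (Delta d n) (P n).

(* T is A / A_{>=1}: the map A -> T, a |-> a e, has degree zero, is onto and  *)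
(* has kernel A_{>=1}.                                                        *)
Definition trivial_module (T : gradedModule) : Prop :=
  exists e : T, [/\ gm_deg 0 e, forall x : T, exists a : A, x = a *: e
    & forall a : A, a *: e = 0 <-> irrelevant a].

Definition bikoszul_algebra (d : nat) : Prop :=
  exists T : gradedModule, trivial_module T /\ has_Delta_resolution d T.

Definition bikoszul_module (d : nat) (M : gradedModule) : Prop :=
  bikoszul_algebra d /\ has_Delta_resolution d M.

Definition matrix_representation (M N : gradedModule) (f : M -> N)
    (s t : nat) (x : 'I_s -> M) (y : 'I_t -> N) (F : 'M[A]_(s, t)) : Prop :=
  forall i, f (x i) = \sum_j F i j *: y j.

(* Admissibility of the matrix block_mx F' 0 U F''. *)
Definition admissible (s1 t1 s2 t2 : nat) (F' : 'M[A]_(s1, s2))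
    (U : 'M[A]_(t1, s2)) (F'' : 'M[A]_(t1, t2)) : Prop :=
  [/\ F' <> 0, F'' <> 0
    & forall X'' : 'rV[A]_t1, exists X' : 'rV[A]_s1, X'' *m U = X' *m F'].

(* s m and t m are the sizes of the two blocks of the basis e m of Q m; they  *)
(* cut both the rows of F_m and the columns of F_(m+1), which is the          *)
(* consistency of F_(m+1) F_m with block multiplication. When t m = 0, the    *)
(* blocks U and F'' have no rows and block_mx F' 0 U F'' is (F' 0).           *)
Definition decomposable (d : nat) (Q : gradedSequence) : Prop :=
  exists (s t : nat -> nat) (dg : forall m, 'I_(s m + t m) -> int)
         (e : forall m, 'I_(s m + t m) -> Q m),
  [/\ forall m, homogeneous_basis (dg m) (e m),
      forall m, ~ is_zero (Q m.+1) ->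
        exists (F' : 'M[A]_(s m.+1, s m)) (U : 'M[A]_(t m.+1, s m))
               (F'' : 'M[A]_(t m.+1, t m)),
          matrix_representation (cdiff Q m) (e m.+1) (e m)
            (block_mx F' 0 U F'') /\
          (admissible F' U F'' \/
           [/\ is_zero (Q m.+2), (m.+1 %% 3 <> 2)%N & t m.+1 = 0%N])
    & forall n, let m := (3 * n + 2)%N in ~ is_zero (Q m) ->
        s m = #|[set i | dg m i == (2 * n * d + d)%N%:Z]| ].

Lemma dirsum_graded (M N : gradedModule) :
  graded_module_axioms
    (fun i (z : (M * N)%type) => gm_deg i z.1 /\ gm_deg i z.2).
Proof.
have [[M0 MB Mex Mu] Ms] := gm_axioms M; have [[N0 NB Nex Nu] Ns] := gm_axioms N.
have sum1 (s : seq int) (u : int -> (M * N)%type) :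
    (\sum_(i <- s) u i).1 = \sum_(i <- s) (u i).1.
  by elim: s => [|i s IH]; rewrite ?big_nil ?big_cons //= IH.
have sum2 (s : seq int) (u : int -> (M * N)%type) :
    (\sum_(i <- s) u i).2 = \sum_(i <- s) (u i).2.
  by elim: s => [|i s IH]; rewrite ?big_nil ?big_cons //= IH.
split; first split.
- by move=> i; split; [exact: M0 | exact: N0].
- by move=> i x y [x1 x2] [y1 y2]; split; [exact: MB | exact: NB].
- move=> [x y]; have [s [u [us uG ->]]] := Mex x.
  have [r [v [ur vG ->]]] := Nex y.
  pose w (T : zmodType) (l : seq int) (f : int -> T) i :=
    if i \in l then f i else 0.
  have ext (T : zmodType) (l l' : seq int) (f : int -> T) : uniq l ->
      \sum_(i <- undup (l ++ l')) w T l f i = \sum_(i <- l) f i.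
    move=> ul; rewrite /w -big_mkcond /= -big_filter; apply: perm_big.
    apply: uniq_perm => //; first by rewrite filter_uniq ?undup_uniq.
    by move=> i; rewrite mem_filter mem_undup mem_cat; case: (i \in l).
  exists (undup (s ++ r)), (fun i => (w _ s u i, w _ r v i)); split.
  + exact: undup_uniq.
  + by move=> i; rewrite /w; split=> /=; case: ifP.
  + rewrite [RHS]surjective_pairing sum1 sum2 /=; congr pair.
      by rewrite (ext _ s r u us).
    rewrite -(ext _ r s v ur); apply: perm_big; apply: uniq_perm;
      rewrite ?undup_uniq // => i; by rewrite !mem_undup !mem_cat orbC.
- move=> s u us uG u0 i si; rewrite [LHS]surjective_pairing.
  rewrite (Mu s (fun i => (u i).1) us (fun i => proj1 (uG i)) _ i si);
    last by rewrite -sum1 u0.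
  by rewrite (Nu s (fun i => (u i).2) us (fun i => proj2 (uG i)) _ i si) //
    -sum2 u0.
- by move=> i j a x ai [x1 x2]; split; [exact: Ms | exact: Ns].
Qed.

Definition dirsum (M N : gradedModule) : gradedModule :=
  GradedModule (dirsum_graded M N).

Section DirsumMap.

Context (M M' N N' : gradedModule).
Context (f : {linear M -> N}) (g : {linear M' -> N'}).

Definition dirsum_map (z : dirsum M M') : dirsum N N' := (f z.1, g z.2).

Lemma dirsum_map_linear : linear dirsum_map.
Proof. by move=> a x y; rewrite /dirsum_map /= !linearP. Qed.

HB.instance Definition _ :=
  GRing.isLinear.Build A (dirsum M M') (dirsum N N') _ dirsum_map
    dirsum_map_linear.

End DirsumMap.

Definition sequence_dirsum (C D : gradedSequence) : gradedSequence :=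
  @GradedSequence (fun n => dirsum (C n) (D n))
    (fun n => dirsum_map (cdiff C n) (cdiff D n)).

Definition sequence_iso (C D : gradedSequence) : Prop :=
  exists phi : forall n, {linear C n -> D n},
    (forall n, degree_zero (phi n) /\ bijective (phi n)) /\
    forall n x, phi n (cdiff C n x) = cdiff D n (phi n.+1 x).

Definition short_exact (M' M M'' : gradedModule) (f : {linear M' -> M})
    (g : {linear M -> M''}) : Prop :=
  [/\ injective f, surjective g & forall x, g x = 0 <-> exists y, x = f y].

End GradedModules.

Arguments connected {k} A.
Arguments noetherian {k} A.

(* Main.v *)
(* Admissibility says that U = Y F' for some matrix Y, so U can be removed     *)
(* from the matrix F of the differential by a shear of the second block of    *)
(* the basis of its source. The shear changes U in the next differential, but *)
(* the new U is still a multiple of F', because Q is exact and d d = 0. Doing *)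
(* this degree by degree splits Q into the subcomplexes spanned by the first  *)
(* and by the sheared second blocks; the augmentation maps their terms of     *)
(* index 0 onto complementary submodules M' and M'' of M, which they resolve. *)
(* Purity: comparing Q with a resolution generated in degrees Delta shows     *)
(* that the basis degrees of Q_n lie in Delta n, and for n = 2 mod 3 the size *)
(* of the first block separates the two possible degrees.                     *)

Require Import Defs.
From HB Require Import structures.
From mathcomp Require Import all_boot all_order all_algebra.
From mathcomp Require Import boolp.

Set Implicit Arguments.
Unset Strict Implicit.
Unset Printing Implicit Defensive.

Import Order.TTheory GRing.Theory.
Local Open Scope ring_scope.

(** * Homogeneous components *)

(** Let L_n and R_n be the spans of the first and second blocks of the basis of Q_n. The block form
    gives d L_(n+1) <= L_n, and admissibility says that every boundary in Q_n lies in R_n up to an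
    element of d L_(n+1) ([block_row_space]). The R_n need not be stable under d, so
    [sheared_stable_complement] replaces them by stable complements S_n of L_n, correcting each
    generator of R_(n+1) by a homogeneous element of L_(n+1). This needs the L_n-part of every
    boundary to come from L_(n+1). For n = 0 this is admissibility. Afterwards, if d x = p + q with
    p in L_(n+1) and q in S_(n+1), then d p = - d q lies in L_n and in S_n, hence is 0; so p is a
    boundary by exactness, and admissibility moves its source into L_(n+2).

    A complex that is the direct sum of two subcomplexes passes exactness, projectivity and
    minimality on to each of them, and M is the direct sum of the images of L_0 and S_0
    ([summand_resolution], [image_complement]). The required short exact sequence is the resulting
    split one.

    For purity, the comparison maps between Q and a resolution generated in degrees Delta compose to
    the identity of Q modulo A_{>=1} Q ([minimal_endomorphism]). This forces each basis degree of
    Q_n into Delta n ([basis_degree]), and a count separates the two degrees when n = 2 mod 3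
    ([sorted_two_values]). *)

Lemma dependent_choice_family (T : nat -> Type) (I : forall n, T n -> Prop)
    (R : forall n, T n -> T n.+1 -> Prop) (x0 : T 0%N) :
  I 0%N x0 -> (forall n x, I n x -> exists y, I n.+1 y /\ R n x y) ->
  exists2 f : forall n, T n, f 0%N = x0
    & forall n, I n (f n) /\ R n (f n) (f n.+1).
Proof.
move=> I0 step.
have {}step n (x : {x : T n | I n x}) : {y : {y : T n.+1 | I n.+1 y} |
    R n (sval x) (sval y)}.
  apply: cid; case: x => x Ix; have [y [Iy Rxy]] := step n x Ix.
  by exists (exist _ y Iy).
pose F := fix F n : {x : T n | I n x} :=
  if n is m.+1 then sval (step m (F m)) else exist _ x0 I0.
exists (fun n => sval (F n)) => // n; split; first exact: svalP (F n).
exact: (svalP (step n (F n))).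
Qed.

Section Components.

Context (I : eqType) (V : zmodType) (G : I -> V -> Prop).
Hypothesis Gdec : direct_sum_decomposition G.

Definition component_spec (x : V) (u : I -> V) : Prop :=
  (forall i, G i (u i)) /\ exists s : seq I,
    [/\ uniq s, forall i, i \notin s -> u i = 0 & x = \sum_(i <- s) u i].

Lemma sum_support (s r : seq I) (u : I -> V) :
  uniq s -> uniq r -> {subset s <= r} -> (forall i, i \notin s -> u i = 0) ->
  \sum_(i <- r) u i = \sum_(i <- s) u i.
Proof.
move=> us ur sr u0; rewrite (bigID (mem s)) /= [X in _ + X]big1 ?addr0.
  by rewrite -big_filter; apply: perm_big; apply: uniq_perm;
    rewrite ?filter_uniq // => i; rewrite mem_filter; case: (boolP (i \in s))
    => // /sr.
by move=> i /u0.
Qed.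

Lemma component_spec_ex (x : V) : exists u, component_spec x u.
Proof.
have [G0 _ Gex _] := Gdec; have [s [u [us uG ->]]] := Gex x.
exists (fun i => if i \in s then u i else 0); split=> [i|]; first by case: ifP.
exists s; split=> // [i /negbTE -> //|].
by apply: eq_big_seq => i ->.
Qed.

Definition component (x : V) (i : I) : V := sval (cid (component_spec_ex x)) i.

Lemma componentP x : component_spec x (component x).
Proof. exact: (svalP (cid (component_spec_ex x))). Qed.

Lemma component_deg x i : G i (component x i).
Proof. by have [] := componentP x. Qed.

Lemma component_specB x y u v : component_spec x u -> component_spec y v ->
  component_spec (x - y) (fun i => u i - v i).
Proof.
have [_ GB _ _] := Gdec.
move=> [uG [s [us u0 ->]]] [vG [r [ur v0 ->]]]; split=> [i|]; first exact: GB.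
exists (undup (s ++ r)); split; first exact: undup_uniq.
  move=> i; rewrite mem_undup mem_cat negb_or => /andP[/u0 -> /v0 ->].
  by rewrite subr0.
rewrite sumrB (@sum_support s _ u) ?(@sum_support r _ v) ?undup_uniq //.
  by move=> i; rewrite mem_undup mem_cat orbC => ->.
by move=> i; rewrite mem_undup mem_cat => ->.
Qed.

(** The difference of two decompositions of [x] decomposes 0, so directness kills each of its terms.
    Later identities between components are proved by exhibiting a candidate decomposition. *)
Lemma component_eq x u : component_spec x u -> forall i, component x i = u i.
Proof.
move=> ux i; have [wG [s [us w0 ws]]] := component_specB (componentP x) ux.
have [_ _ _ Gu] := Gdec; rewrite subrr in ws.
case: (boolP (i \in s)) => [si|/w0 wi]; last exact: subr0_eq.
exact/subr0_eq/(Gu s _ us wG (esym ws) i si).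
Qed.

Lemma componentB x y i : component (x - y) i = component x i - component y i.
Proof.
exact: component_eq (component_specB (componentP x) (componentP y)) i.
Qed.

Lemma component0 i : component 0 i = 0.
Proof. by have := componentB 0 0 i; rewrite !subrr. Qed.

Lemma componentD x y i : component (x + y) i = component x i + component y i.
Proof.
by rewrite -[y in LHS]opprK -[- y]sub0r !componentB component0 sub0r opprK.
Qed.

Lemma component_sum (J : Type) (r : seq J) (F : J -> V) i :
  component (\sum_(j <- r) F j) i = \sum_(j <- r) component (F j) i.
Proof.
by apply: (big_morph (component^~ i)) => [x y|]; rewrite ?componentD ?component0.
Qed.

Lemma component_homogeneous j x i : G j x ->
  component x i = if i == j then x else 0.
Proof.
have [G0 _ _ _] := Gdec.
move=> Gx; apply: (@component_eq x (fun i => if i == j then x else 0)).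
split=> [l|]; first by case: eqP => // ->.
exists [:: j]; split=> // [l|]; first by rewrite inE => /negbTE ->.
by rewrite big_seq1 eqxx.
Qed.

Lemma component_id j x : G j x -> component x j = x.
Proof. by move/component_homogeneous->; rewrite eqxx. Qed.

Lemma sum_component x : exists s : seq I, x = \sum_(i <- s) component x i.
Proof. by have [_ [s [_ _ xs]]] := componentP x; exists s. Qed.

End Components.

Section GradedModuleComponents.

Context (k : fieldType) (A : gradedAlgebra k).

Notation acomp := (component (ga_direct (ga_axioms A))).

Definition mcomp (N : gradedModule A) : N -> int -> N :=
  component (gm_direct (gm_axioms N)).

Lemma component_degree_zero (N N' : gradedModule A) (f : {linear N -> N'}) :
  degree_zero f -> forall x i, mcomp (f x) i = f (mcomp x i).
Proof.
move=> f0 x i; apply: (component_eq (gm_direct (gm_axioms N'))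
  (u := fun i => f (mcomp x i))).
have [xG [s [us x0 xs]]] := componentP (gm_direct (gm_axioms N)) x.
split=> [j|]; first exact/f0/xG.
exists s; split=> // [j /x0|]; first by rewrite /mcomp => ->; rewrite raddf0.
by rewrite {1}xs raddf_sum.
Qed.

(* The degree [l - j] may be negative, where [A] vanishes. *)
Definition shifted_component (a : A) (j l : int) : A :=
  if l - j is Posz m then acomp a m else 0.

Lemma component_scale (N : gradedModule A) (a : A) (x : N) j l :
  gm_deg j x -> mcomp (a *: x) l = shifted_component a j l *: x.
Proof.
move=> xj; have [s aE] := sum_component (ga_direct (ga_axioms A)) a.
have tE m : mcomp (acomp a m *: x) l =
    if l == m%:Z + j then acomp a m *: x else 0.
  apply: component_homogeneous; apply: (gm_scale (gm_axioms N)) => //.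
  exact: component_deg.
rewrite {1}aE scaler_suml /mcomp component_sum /shifted_component.
under eq_bigr do rewrite -/(mcomp _ _) tE.
have lE m : (l == m%:Z + j) = (l - j == m%:Z) by rewrite subr_eq.
under eq_bigr do rewrite lE.
case: (l - j) => m; last first.
  by rewrite scale0r big1.
rewrite [acomp a m in RHS](congr1 (component _ ^~ m) aE) component_sum scaler_suml.
apply: eq_bigr => j' _.
rewrite (component_homogeneous _ m (component_deg _ a j')) eqz_nat.
by case: ifP; rewrite ?scale0r.
Qed.

Lemma shifted_component_homogeneous (a : A) j l :
  shifted_component a j l = 0 \/
  exists m : nat, ga_deg m (shifted_component a j l) /\ m%:Z + j = l.
Proof.
rewrite /shifted_component; case: (l - j) (subrK j l) => m lE; last by left.
by right; exists m; split=> //; exact: component_deg.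
Qed.

End GradedModuleComponents.

(** * Graded submodules *)

Section GradedSubmodules.

Context (k : fieldType) (A : gradedAlgebra k).

Definition linear_pack (X Y : lmodType A) (f : X -> Y) (fl : linear f) :
  {linear X -> Y} := HB.pack f (GRing.isLinear.Build A X Y _ f fl).

Record graded_submodule_axioms (N : gradedModule A) (P : N -> Prop) : Prop :=
  GradedSubmoduleAxioms {
    gs_zero : P 0;
    gs_lin : forall (a : A) x y, P x -> P y -> P (a *: x + y);
    gs_comp : forall x i, P x -> P (mcomp x i) }.

Structure gradedSubmodule (N : gradedModule A) := GradedSubmodule {
  gs_pred :> N -> Prop;
  gs_axioms : graded_submodule_axioms gs_pred }.

Section Closure.

Context (N : gradedModule A) (P : gradedSubmodule N).

Lemma gs0 : P 0. Proof. exact: gs_zero (gs_axioms P). Qed.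

Lemma gsZD a x y : P x -> P y -> P (a *: x + y).
Proof. exact: gs_lin (gs_axioms P) a x y. Qed.

Lemma gsD x y : P x -> P y -> P (x + y).
Proof. by rewrite -{2}[x]scale1r; exact: gsZD. Qed.

Lemma gsZ a x : P x -> P (a *: x).
Proof. by move=> Px; rewrite -[_ *: _]addr0; apply: gsZD => //; exact: gs0. Qed.

Lemma gsB x y : P x -> P y -> P (x - y).
Proof. by move=> Px Py; rewrite addrC -scaleN1r; exact: gsZD. Qed.

Lemma gs_sum (I : Type) (r : seq I) (F : I -> N) :
  (forall i, P (F i)) -> P (\sum_(i <- r) F i).
Proof. by move=> PF; apply: big_ind => //; [exact: gs0 | exact: gsD]. Qed.

(** Classical reflection of [P] into a boolean predicate, so that the submodule and subtype
    structures can be derived for it. *)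
Definition gs_mem : {pred N} := fun x => `[< P x >].

Lemma gs_memP x : reflect (P x) (x \in gs_mem).
Proof. exact: asboolP. Qed.

Lemma gs_mem_submod : submod_closed gs_mem.
Proof.
split; first exact/gs_memP/gs0.
by move=> a x y /gs_memP Px /gs_memP Py; exact/gs_memP/gsZD.
Qed.

HB.instance Definition _ := GRing.isSubmodClosed.Build A N gs_mem gs_mem_submod.

Inductive gsub_sort : predArgType := GSub x of x \in gs_mem.

Definition gsub_val (u : gsub_sort) : N := let: GSub x _ := u in x.

HB.instance Definition _ := [isSub for gsub_val].
HB.instance Definition _ := [Choice of gsub_sort by <:].
HB.instance Definition _ := [SubChoice_isSubLmodule of gsub_sort by <:].

Lemma gsub_valP (u : gsub_sort) : P (val u).
Proof. by case: u => x Px; exact/gs_memP. Qed.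

Definition gsub_elt (x : N) (Px : P x) : gsub_sort := GSub (introT (gs_memP x) Px).

Lemma val_sum (I : Type) (r : seq I) (F : I -> gsub_sort) :
  val (\sum_(i <- r) F i) = \sum_(i <- r) val (F i).
Proof. by elim/big_rec2: _ => [|i x y _ <-]; rewrite ?raddf0 ?raddfD. Qed.

Lemma gsub_graded :
  graded_module_axioms (fun i (u : gsub_sort) => gm_deg i (val u)).
Proof.
have [[N0 NB Nex Nu] Ns] := gm_axioms N; split; first split.
- by move=> i; rewrite raddf0.
- by move=> i x y xi yi; rewrite raddfB; exact: NB.
- move=> x; have [xG [s [us x0 xs]]] := componentP (gm_direct (gm_axioms N)) (val x).
  exists s, (fun i => gsub_elt (gs_comp (gs_axioms P) i (gsub_valP x))).
  by split=> //; apply: val_inj; rewrite val_sum.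
- move=> s u us uG u0 i si; apply: val_inj; rewrite raddf0.
  apply: (Nu s (fun i => val (u i)) us uG _ i si).
  by rewrite -val_sum u0 raddf0.
- by move=> i j a x ai xj; rewrite linearZ; exact: Ns.
Qed.

Definition gsub : gradedModule A := GradedModule gsub_graded.

Definition gsub_inc : {linear gsub -> N} := val : {linear gsub_sort -> N}.

Lemma gsub_inc_inj : injective gsub_inc. Proof. exact: val_inj. Qed.

Lemma gsub_incP u : P (gsub_inc u). Proof. exact: gsub_valP. Qed.

Lemma gsub_inc_deg i u : gm_deg i u <-> gm_deg i (gsub_inc u).
Proof. by []. Qed.

Lemma gsub_lift (x : N) : P x -> exists u : gsub, gsub_inc u = x.
Proof. by move=> Px; exists (gsub_elt Px). Qed.

End Closure.

Arguments gsub_inc {N P}.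

Lemma gsub_corestrict (X N : gradedModule A) (P : gradedSubmodule N)
    (f : {linear X -> N}) :
  (forall x, P (f x)) -> {g : {linear X -> gsub P} | forall x, gsub_inc (g x) = f x}.
Proof.
move=> Pf; pose g x : gsub P := gsub_elt (Pf x).
have gl : linear g.
  by move=> a x y; apply: gsub_inc_inj; rewrite linearP /= linearP.
by exists (linear_pack gl).
Qed.

Lemma image_graded (X N : gradedModule A) (f : {linear X -> N})
    (P : gradedSubmodule X) : degree_zero f ->
  graded_submodule_axioms (fun y => exists2 x, P x & y = f x).
Proof.
move=> f0; split.
- by exists 0; [exact: gs0 | rewrite linear0].
- by move=> a _ _ [x Px ->] [y Py ->]; exists (a *: x + y); [exact: gsZD | rewrite linearP].
- move=> _ i [x Px ->]; exists (mcomp x i); first exact: gs_comp (gs_axioms P) _ _ Px.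
  exact: component_degree_zero.
Qed.

Definition graded_image (X N : gradedModule A) (f : {linear X -> N})
    (P : gradedSubmodule X) (f0 : degree_zero f) : gradedSubmodule N :=
  GradedSubmodule (image_graded P f0).

Lemma full_graded (N : gradedModule A) : graded_submodule_axioms (fun _ : N => True).
Proof. by []. Qed.

Definition graded_full (N : gradedModule A) := GradedSubmodule (full_graded N).

(** The degree [l] part of a combination is a combination of the same homogeneous generators, with
    each coefficient replaced by its part of degree [l - dg i]. *)
Lemma span_graded (N : gradedModule A) (n : nat) (dg : 'I_n -> int) (e : 'I_n -> N) :
  (forall i, gm_deg (dg i) (e i)) ->
  graded_submodule_axioms (fun x => exists c : 'I_n -> A, x = \sum_i c i *: e i).
Proof.
move=> edg; split.
- by exists (fun=> 0); rewrite big1 // => i _; rewrite scale0r.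
- move=> a _ _ [c ->] [c' ->]; exists (fun i => a * c i + c' i).
  rewrite scaler_sumr -big_split; apply: eq_bigr => i _ /=.
  by rewrite scalerDl scalerA.
- move=> _ l [c ->]; exists (fun i => shifted_component (c i) (dg i) l).
  rewrite /mcomp component_sum; apply: eq_bigr => i _.
  exact: component_scale.
Qed.

Definition span (N : gradedModule A) (n : nat) (dg : 'I_n -> int) (e : 'I_n -> N)
    (edg : forall i, gm_deg (dg i) (e i)) : gradedSubmodule N :=
  GradedSubmodule (span_graded edg).

Lemma span_gen (N : gradedModule A) (n : nat) (dg : 'I_n -> int) (e : 'I_n -> N)
    (edg : forall i, gm_deg (dg i) (e i)) i : span edg (e i).
Proof.
exists (fun j => (j == i)%:R); rewrite (bigD1 i) //= eqxx scale1r big1 ?addr0 //.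
by move=> j /negbTE ->; rewrite scale0r.
Qed.

Lemma homogeneous_preimage (X N : gradedModule A) (f : {linear X -> N})
    (P : gradedSubmodule X) l x : degree_zero f -> P x -> gm_deg l (f x) ->
  exists x', [/\ P x', gm_deg l x' & f x' = f x].
Proof.
move=> f0 Px fxl; exists (mcomp x l); split.
- exact: gs_comp (gs_axioms P) _ _ Px.
- exact: component_deg.
- by rewrite -component_degree_zero // /mcomp component_id.
Qed.

(** Projectivity lifts only along surjections, so both maps are first corestricted to the image of
    [f]. *)
Lemma projective_lift (X Y Z : gradedModule A) (f : {linear Y -> Z})
    (phi : {linear X -> Z}) :
  graded_projective X -> degree_zero f -> degree_zero phi ->
  (forall x, exists y, phi x = f y) ->
  exists psi : {linear X -> Y}, degree_zero psi /\ forall x, f (psi x) = phi x.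
Proof.
move=> Xproj f0 phi0 im; pose P := graded_image (graded_full Y) f0.
have [g gE] := gsub_corestrict (P := P) (f := f) (fun y => ex_intro2 _ _ y I erefl).
have [h hE] : {h : {linear X -> gsub P} | forall x, gsub_inc (h x) = phi x}.
  by apply: gsub_corestrict => x; have [y ->] := im x; exists y.
have [|||psi [psi0 psiE]] := Xproj _ _ g h.
- by move=> i y yi; apply/gsub_inc_deg; rewrite gE; exact/f0.
- by move=> i y yi; apply/gsub_inc_deg; rewrite hE; exact: phi0.
- move=> u; have [y _ uy] := gsub_incP u; exists y; apply: gsub_inc_inj.
  by rewrite gE uy.
- by exists psi; split=> // x; rewrite -gE psiE hE.
Qed.

Section Bases.

Context (N : gradedModule A) (n : nat) (dg : 'I_n -> int) (e : 'I_n -> N).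
Hypothesis ebasis : homogeneous_basis dg e.

Lemma basis_coord : exists c : {linear N -> 'rV[A]_n},
  (forall x, x = \sum_i c x 0 i *: e i) /\
  forall v : 'rV[A]_n, c (\sum_i v 0 i *: e i) = v.
Proof.
have [_ _ ex] := ebasis.
have [c cP] : {c : N -> 'rV[A]_n & forall x, x = \sum_i c x 0 i *: e i}.
  apply: (@choice _ _ (fun x (c : 'rV[A]_n) => x = \sum_i c 0 i *: e i)) => x.
  by have [c [cx _]] := ex x; exists c.
have cU x (v : 'rV[A]_n) : x = \sum_i v 0 i *: e i -> c x = v.
  by have [w [_ wU]] := ex x; move=> /wU <-; rewrite -(wU _ (cP x)).
have cl : linear c.
  move=> a x y; apply: cU; rewrite {1}(cP x) {1}(cP y) scaler_sumr -big_split.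
  by apply: eq_bigr => i _; rewrite !mxE scalerDl scalerA.
by exists (linear_pack cl); split=> // v; exact: cU.
Qed.

(** Taking the degree [l] part of the combination gives a second coordinate row for the same
    element; uniqueness of coordinates identifies the two. *)
Lemma homogeneous_coord (c : 'rV[A]_n) l i :
  gm_deg l (\sum_i c 0 i *: e i) ->
  c 0 i = 0 \/ exists m : nat, ga_deg m (c 0 i) /\ m%:Z + dg i = l.
Proof.
have [edg _ ex] := ebasis.
move=> cl; have [w [_ wU]] := ex (\sum_i c 0 i *: e i).
have cE : c = \row_j shifted_component (c 0 j) (dg j) l.
  rewrite -[LHS](wU _ erefl); apply: wU.
  rewrite -[LHS](component_id (gm_direct (gm_axioms N)) cl) component_sum.
  by apply: eq_bigr => j _; rewrite mxE; exact: component_scale.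
by rewrite cE mxE; exact: shifted_component_homogeneous.
Qed.

Lemma basis_projective : graded_projective N.
Proof.
have [edg _ _] := ebasis; have [c [cP cK]] := basis_coord.
move=> Y Z g h g0 h0 gs.
have [y yP] : {y : 'I_n -> Y & forall i,
    gm_deg (dg i) (y i) /\ g (y i) = h (e i)}.
  apply: (@choice _ _ (fun i y => gm_deg (dg i) y /\ g y = h (e i))) => i.
  have [y yE] := gs (h (e i)).
  have [|y' [_ y'd y'E]] := @homogeneous_preimage _ _ g (graded_full Y) (dg i) y g0 I.
    by rewrite yE; exact/h0/edg.
  by exists y'; rewrite y'E.
have fl : linear (fun x => \sum_i c x 0 i *: y i).
  move=> a u v; rewrite linearP scaler_sumr -big_split.
  by apply: eq_bigr => i _; rewrite !mxE scalerDl scalerA.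
exists (linear_pack fl); split=> [l x xl|x] /=.
  have [[Y0 YB _ _] Ys] := gm_axioms Y; apply: (big_ind (@gm_deg _ _ Y l)).
  - exact: Y0.
  - by move=> u v ul vl; rewrite -[v]opprK -[- v]sub0r;
    exact/YB/YB.
  - move=> i _; rewrite (cP x) in xl.
    have [->|[m [cm <-]]] := homogeneous_coord i xl; first by rewrite scale0r.
    by apply: Ys => //; have [] := yP i.
rewrite [in RHS](cP x) !linear_sum; apply: eq_bigr => i _.
by rewrite !linearZ; have [_ ->] := yP i.
Qed.

End Bases.

End GradedSubmodules.

Arguments gsub_inc {k A N P}.

(** * Direct summands of resolutions *)

Section Summands.

Context (k : fieldType) (A : gradedAlgebra k).

Definition complement (N : gradedModule A) (P R : gradedSubmodule N) : Prop :=
  (forall x, exists2 y, P y & R (x - y)) /\ (forall x, P x -> R x -> x = 0).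

Lemma complementC (N : gradedModule A) (P R : gradedSubmodule N) :
  complement P R -> complement R P.
Proof.
move=> [ex uq]; split=> [x|x Rx Px]; last exact: uq.
by have [y Py Rxy] := ex x; exists (x - y); rewrite // subKr.
Qed.

Lemma complement_proj (N : gradedModule A) (P R : gradedSubmodule N) :
  complement P R -> exists p : {linear N -> gsub P},
    [/\ degree_zero p, forall u : gsub P, p (gsub_inc u) = u,
        forall x, R (x - gsub_inc (p x)) & forall x, R x -> p x = 0].
Proof.
move=> [ex uq].
have [p pP] : {p : N -> gsub P & forall x, R (x - gsub_inc (p x))}.
  apply: (@choice _ _ (fun x (u : gsub P) => R (x - gsub_inc u))) => x.
  by have [y /gsub_lift[u <-] Rxy] := ex x; exists u.
have pU x u : R (x - gsub_inc u) -> p x = u.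
  move=> Rxu; apply: gsub_inc_inj; apply: subr0_eq; apply: uq.
    by apply: gsB; exact: gsub_incP.
  suff -> : gsub_inc (p x) - gsub_inc u =
      (x - gsub_inc u) - (x - gsub_inc (p x)) by apply: gsB.
  by rewrite opprB [RHS]addrC addrA addrNK.
have pl : linear p.
  move=> a x y; apply: pU; rewrite (linearP gsub_inc) opprD addrACA -scalerBr.
  exact: gsZD.
exists (linear_pack pl); split=> // [l x xl|u|x Rx].
- rewrite -[linear_pack pl x]/(p x).
  (* The projection preserves degrees because [R] is graded: the degree [l] part of [x - p x] is
     again in [R], so the degree [l] part of [p x] also has the property that characterizes
     [p x]. *)
  have -> : p x = mcomp (p x) l.
    apply: pU.
    have -> : x - gsub_inc (mcomp (p x) l) = mcomp (x - gsub_inc (p x)) l.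
      have inc0 : degree_zero (@gsub_inc _ _ _ P) by [].
      by rewrite /mcomp componentB (component_id _ xl) -!/(mcomp _ _)
        (component_degree_zero inc0).
    exact/(gs_comp (gs_axioms R))/pP.
  exact: component_deg.
- by apply: pU; rewrite subrr; exact: gs0.
- by apply: pU; rewrite (linear0 gsub_inc) subr0.
Qed.

Lemma summand_projective (N : gradedModule A) (P R : gradedSubmodule N) :
  complement P R -> graded_projective N -> graded_projective (gsub P).
Proof.
move=> /complement_proj[p [p0 pK _ _]] Nproj X Y g h g0 h0 gs.
have [|f [f0 fE]] := Nproj X Y g (h \o p) g0 _ gs.
- by move=> l x xl /=; exact/h0/p0.
- exists (f \o gsub_inc); split=> [l u ul|u] /=; first exact: f0.
  by rewrite fE /= pK.
Qed.

Lemma gsub_generated (N : gradedModule A) (P : gradedSubmodule N) (n : nat)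
    (b : 'I_n -> N) (j : int) :
  (forall i, P (b i) /\ gm_deg j (b i)) ->
  (forall x, P x -> exists c : 'I_n -> A, x = \sum_i c i *: b i) ->
  generated_in [:: j] (gsub P).
Proof.
move=> bP Pspan u; have [c uE] := Pspan _ (gsub_incP u).
have [b' b'E] : {b' : 'I_n -> gsub P & forall i, gsub_inc (b' i) = b i}.
  apply: (@choice _ _ (fun i (v : gsub P) => gsub_inc v = b i)) => i.
  by apply: gsub_lift; have [] := bP i.
exists n, c, b'; split=> [i|].
  exists j; first exact: mem_head.
  by apply/gsub_inc_deg; rewrite b'E; have [] := bP i.
apply: gsub_inc_inj; rewrite uE linear_sum; apply: eq_bigr => i _.
by rewrite linearZ b'E.
Qed.

Section Subsequence.

Context (Q : gradedSequence A) (P R : forall n, gradedSubmodule (Q n)).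

Definition stable (P : forall n, gradedSubmodule (Q n)) : Prop :=
  forall n x, P n.+1 x -> P n (cdiff Q n x).

Hypotheses (Pst : stable P) (Rst : stable R).
Hypothesis PR : forall n, complement (P n) (R n).

Definition restrict_diff n :=
  gsub_corestrict (P := P n) (f := cdiff Q n \o @gsub_inc _ _ _ (P n.+1))
    (fun u => Pst (gsub_incP u)).

Definition subsequence : gradedSequence A :=
  @GradedSequence _ _ (fun n => gsub (P n)) (fun n => sval (restrict_diff n)).

Lemma subsequence_diff n (u : gsub (P n.+1)) :
  gsub_inc (cdiff subsequence n u) = cdiff Q n (gsub_inc u).
Proof. exact: (svalP (restrict_diff n) u). Qed.

(** Minimality expresses a boundary through elements of all of [Q n]; the projection onto [P n]
    moves them into the summand without changing the coefficients. *)
Lemma summand_minimal : minimal Q -> minimal subsequence.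
Proof.
move=> Qmin n u; have [p [_ pK _ _]] := complement_proj (PR n).
have [m [a [g [ai dE]]]] := Qmin n (gsub_inc u).
exists m, a, (fun i => p (g i)); split=> //.
rewrite -[LHS]pK subsequence_diff dE linear_sum; apply: eq_bigr => i _.
by rewrite linearZ.
Qed.

Context (M : gradedModule A) (eps : {linear Q 0%N -> M}).
Hypotheses (d0 : forall n, degree_zero (cdiff Q n)) (eps0 : degree_zero eps).
Hypothesis exact0 : forall x, eps x = 0 <-> exists y, x = cdiff Q 0 y.
Hypothesis exactS :
  forall n x, cdiff Q n x = 0 <-> exists y, x = cdiff Q n.+1 y.

(** Split x = y + y' along [P] and [R]. Then d y' = d x - d y lies in both summands, hence vanishes.
    This is what makes exactness descend to the summand. *)
Lemma boundary_summand n x : P n (cdiff Q n x) ->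
  exists2 y, P n.+1 y & cdiff Q n x = cdiff Q n y.
Proof.
move=> Pdx; have [[ex _] [_ uq]] := (PR n.+1, PR n).
have [y Py Rxy] := ex x; exists y => //; apply: subr0_eq; apply: uq.
  by apply: gsB => //; exact: Pst.
by rewrite -linearB; exact: Rst.
Qed.

Lemma summand_resolution : resolution subsequence (gsub (graded_image (P 0%N) eps0)).
Proof.
have [eps' eps'E] := gsub_corestrict (P := graded_image (P 0%N) eps0)
  (f := eps \o @gsub_inc _ _ _ (P 0%N))
  (fun u => ex_intro2 _ _ (gsub_inc u) (gsub_incP u) erefl).
split=> [n l u ul|].
  by apply/gsub_inc_deg; rewrite subsequence_diff; exact: d0.
exists eps'; split.
- by move=> l u ul; apply/gsub_inc_deg; rewrite eps'E; exact: eps0.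
- move=> v; have [x /gsub_lift[u <-] vE] := gsub_incP v.
  by exists u; apply: gsub_inc_inj; rewrite eps'E vE.
- move=> u; split=> [u0|[v ->]].
    have /exact0[x xE] : eps (gsub_inc u) = 0.
      by have := eps'E u; rewrite u0 linear0.
    have [|y /gsub_lift[v <-] yE] := @boundary_summand 0 x.
      by rewrite -xE; exact: gsub_incP.
    by exists v; apply: gsub_inc_inj; rewrite subsequence_diff xE.
  apply: gsub_inc_inj; rewrite eps'E linear0 /=; apply/exact0.
  by exists (gsub_inc v); rewrite -subsequence_diff.
- move=> n u; split=> [u0|[v ->]].
    have /exactS[x xE] : cdiff Q n (gsub_inc u) = 0.
      by rewrite -subsequence_diff u0 linear0.
    have [|y /gsub_lift[v <-] yE] := @boundary_summand n.+1 x.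
      by rewrite -xE; exact: gsub_incP.
    by exists v; apply: gsub_inc_inj; rewrite subsequence_diff xE.
  apply: gsub_inc_inj; rewrite subsequence_diff linear0; apply/exactS.
  by exists (gsub_inc v); rewrite -subsequence_diff.
Qed.

Lemma image_complement : surjective eps ->
  complement (graded_image (P 0%N) eps0) (graded_image (R 0%N) eps0).
Proof.
move=> epss; have [ex uq] := PR 0; split=> [m|_ [x Px ->] [y Ry]].
  have [x <-] := epss m; have [y Py Rxy] := ex x.
  by exists (eps y); [exists y | exists (x - y); rewrite ?linearB].
move/eqP; rewrite -subr_eq0 -linearB => /eqP/exact0[z zE].
(* Here x - y = d z. With z = z1 + z2 split along [P] and [R], the element x - d z1 = d z2 + y lies
   in both summands, so x = d z1 and [eps] kills it. *)
have [[ex1 _] [_ uq0]] := (PR 1, PR 0); have [z1 Pz1 Rz1] := ex1 z.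
apply/exact0; exists z1; apply: subr0_eq; apply: uq0.
  by apply: gsB => //; exact: Pst.
have -> : x - cdiff Q 0 z1 = cdiff Q 0 (z - z1) + y.
  by rewrite linearB -zE addrAC addrNK.
by apply: gsD => //; exact: Rst.
Qed.

End Subsequence.

Lemma summands_iso (Q : gradedSequence A) (P R : forall n, gradedSubmodule (Q n))
    (Pst : stable P) (Rst : stable R) : (forall n, complement (P n) (R n)) ->
  sequence_iso Q (sequence_dirsum (subsequence Pst) (subsequence Rst)).
Proof.
move=> PR; pose S := sequence_dirsum (subsequence Pst) (subsequence Rst).
pose psi n (z : S n) : Q n := gsub_inc z.1 + gsub_inc z.2.
have phiP n : exists phi : {linear Q n -> S n},
    [/\ degree_zero phi, cancel phi (psi n) & cancel (psi n) phi].
  have [p [p0 pK pR pR0]] := complement_proj (PR n).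
  have [q [q0 qK qP qP0]] := complement_proj (complementC (PR n)).
  have fl : linear (fun x => (p x, q x) : S n).
    by move=> a x y; rewrite !linearP.
  have fE x : x = gsub_inc (p x) + gsub_inc (q x).
    apply: subr0_eq; have [_ uq] := PR n; apply: uq.
      by rewrite opprD addrCA; apply: gsD; [rewrite -[- _]sub0r; apply: gsB;
        [exact: gs0 | exact: gsub_incP] | exact: qP].
    by rewrite opprD addrA; apply: gsB => //; exact: gsub_incP.
  exists (linear_pack fl); split=> [l x xl|x|[u v]] /=.
  - by split; [exact: p0 | exact: q0].
  - exact/esym/fE.
  - rewrite /psi /= !linearD pK qK (pR0 _ (gsub_incP v)) (qP0 _ (gsub_incP u)).
    by rewrite addr0 add0r.
pose phi n := sval (cid (phiP n)).
have phiE n : [/\ degree_zero (phi n), cancel (phi n) (psi n)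
    & cancel (psi n) (phi n)] by exact: svalP (cid (phiP n)).
exists phi; split=> [n|n x]; have [phi0 phiK psiK] := phiE n.
  by split=> //; exists (psi n).
(* Compatibility with the differentials is checked after applying the inverse [psi], a sum of
   inclusions, which commutes with them by [subsequence_diff]. *)
apply: (can_inj psiK); rewrite phiK /psi [_.1]/= [X in gsub_inc X + _]/=.
have [_ phiSK _] := phiE n.+1; rewrite -{1}[x]phiSK linearD.
by rewrite -!subsequence_diff.
Qed.

Lemma complement_short_exact (M : gradedModule A) (P R : gradedSubmodule M) :
  complement P R -> exists (f : {linear gsub P -> M}) (g : {linear M -> gsub R}),
    [/\ degree_zero f, degree_zero g & short_exact f g].
Proof.
move=> /complementC PR; have [q [q0 qK qP qP0]] := complement_proj PR.
exists gsub_inc, q; split=> //; split; first exact: gsub_inc_inj.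
  by move=> u; exists (gsub_inc u).
move=> x; split=> [x0|[u ->]]; last exact/qP0/gsub_incP.
have := qP x; rewrite x0 (linear0 gsub_inc) subr0 => /gsub_lift[u <-]; by exists u.
Qed.

End Summands.

(** * Degrees of generators of minimal resolutions *)

Section Comparison.

Context (k : fieldType) (A : gradedAlgebra k).

Notation acomp := (component (ga_direct (ga_axioms A))).

Definition exact_augmentation (Q : gradedSequence A) (M : gradedModule A)
    (eps : {linear Q 0%N -> M}) : Prop :=
  [/\ forall n, degree_zero (cdiff Q n), degree_zero eps, surjective eps,
      forall x, eps x = 0 <-> exists y, x = cdiff Q 0 y
    & forall n x, cdiff Q n x = 0 <-> exists y, x = cdiff Q n.+1 y].

Lemma resolution_augmentation Q M : resolution Q M ->
  exists eps : {linear Q 0%N -> M}, exact_augmentation eps.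
Proof. by move=> [d0 [eps [*]]]; exists eps. Qed.

(** The usual comparison theorem. The invariant [I] carried along the construction says that the
    current map sends boundaries to boundaries, which is what the next lift needs. *)
Lemma comparison_map (P Q : gradedSequence A) (M : gradedModule A)
    (epsP : {linear P 0%N -> M}) (epsQ : {linear Q 0%N -> M}) :
  exact_augmentation epsP -> exact_augmentation epsQ ->
  (forall n, graded_projective (P n)) ->
  exists f : forall n, {linear P n -> Q n},
    [/\ forall n, degree_zero (f n), forall x, epsQ (f 0%N x) = epsP x
      & forall n x, cdiff Q n (f n.+1 x) = f n (cdiff P n x)].
Proof.
move=> [dP0 eP0 _ exP0 exP] [dQ0 eQ0 eQs exQ0 exQ] Pproj.
have [f0 [f00 f0E]] : exists f0 : {linear P 0%N -> Q 0%N},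
    degree_zero f0 /\ forall x, epsQ (f0 x) = epsP x.
  by apply: projective_lift => // x; have [y <-] := eQs (epsP x); exists y.
pose I n (f : {linear P n -> Q n}) :=
  degree_zero f /\ forall x, exists y, f (cdiff P n x) = cdiff Q n y.
have [||f f0' fE] := @dependent_choice_family
    (fun n => {linear P n -> Q n}) I
    (fun n f f1 => forall x, cdiff Q n (f1 x) = f (cdiff P n x)) f0.
- split=> // x; apply/exQ0; rewrite f0E; apply/exP0; by exists x.
- move=> n f [fd fim]; have [|f1 [f1d f1E]] := projective_lift (f := cdiff Q n)
      (phi := f \o cdiff P n) (Pproj n.+1) (dQ0 n) _ fim.
    by move=> l x xl; exact/fd/dP0.
  exists f1; split=> //; split=> // x; apply/exQ; rewrite f1E /=.
  have -> : cdiff P n (cdiff P n.+1 x) = 0 by apply/exP; exists x.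
  exact: linear0.
- exists f; split=> [n|x|n x]; last by have [_ ->] := fE n.
    by have [[]] := fE n.
  by rewrite f0'.
Qed.

Lemma irrelevant_mulD (N : gradedModule A) (x y : N) :
  irrelevant_mul x -> irrelevant_mul y -> irrelevant_mul (x + y).
Proof.
move=> [m [a [g [ai ->]]]] [n [b [h [bi ->]]]].
exists (m + n)%N, (fun i => match split i with inl j => a j | inr j => b j end),
  (fun i => match split i with inl j => g j | inr j => h j end).
split=> [i|]; first by case: split.
rewrite big_split_ord; congr (_ + _); apply: eq_bigr => i _.
  by rewrite (unsplitK (inl _ i)).
by rewrite (unsplitK (inr _ i)).
Qed.

Lemma irrelevant_mul_linear (N N' : gradedModule A) (f : {linear N -> N'}) x :
  irrelevant_mul x -> irrelevant_mul (f x).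
Proof.
move=> [m [a [g [ai ->]]]]; exists m, a, (fun i => f (g i)); split=> //.
by rewrite linear_sum; apply: eq_bigr => i _; rewrite linearZ.
Qed.

(* A chain endomorphism over [0] is null-homotopic, hence takes values in     *)
(* [A_{>=1} Q] when the resolution is minimal.                                *)
Lemma minimal_endomorphism (Q : gradedSequence A) (M : gradedModule A)
    (eps : {linear Q 0%N -> M}) (theta : forall n, {linear Q n -> Q n}) :
  exact_augmentation eps -> (forall n, graded_projective (Q n)) -> minimal Q ->
  (forall n, degree_zero (theta n)) -> (forall x, eps (theta 0%N x) = 0) ->
  (forall n x, cdiff Q n (theta n.+1 x) = theta n (cdiff Q n x)) ->
  forall n x, irrelevant_mul (theta n x).
Proof.
move=> [d0 _ _ ex0 ex] Qproj Qmin th0 thE thd.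
(* The homotopy relation is kept only after composition with d, as d h d = theta d: the term of the
   previous index then drops out, and the induction needs to remember a single map. *)
have hP n : exists h : {linear Q n -> Q n.+1}, [/\ degree_zero h,
    forall x, cdiff Q n (h (cdiff Q n x)) = theta n (cdiff Q n x)
  & forall x, irrelevant_mul (theta n x)].
  elim: n => [|n [h [hd hE _]]].
    have [|h [hd hE]] := projective_lift (Qproj 0%N) (d0 0%N) (th0 0%N).
      by move=> x; apply/ex0.
    by exists h; split=> // x; rewrite -hE.
  pose phi : {linear Q n.+1 -> Q n.+1} := theta n.+1 \- (h \o cdiff Q n).
  have phiE x : phi x = theta n.+1 x - h (cdiff Q n x) by [].
  have [||h1 [h1d h1E]] :=
      projective_lift (phi := phi) (Qproj n.+1) (d0 n.+1).
  - move=> l x xl; rewrite phiE; have [[_ GB _ _] _] := gm_axioms (Q n.+1).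
    by apply: GB; [exact: th0 | exact/hd/d0].
  - by move=> x; apply/ex; rewrite phiE linearB hE thd subrr.
  exists h1; split=> // x.
    have dd : cdiff Q n (cdiff Q n.+1 x) = 0 by apply/ex; exists x.
    by rewrite h1E phiE dd linear0 subr0.
  have -> : theta n.+1 x = cdiff Q n.+1 (h1 x) + h (cdiff Q n x).
    by rewrite h1E phiE subrK.
  by apply: irrelevant_mulD => //; exact: irrelevant_mul_linear.
by move=> n; have [h []] := hP n.
Qed.

Lemma irrelevant_component0 (a : A) : irrelevant a -> acomp a 0%N = 0.
Proof.
move=> [s [u [/allP s0 uG ->]]]; rewrite component_sum big_seq big1 // => i /s0.
by rewrite (component_homogeneous _ _ (uG i)); case: i.
Qed.

(** Degrees in [A] are natural numbers, so only the two components of degree 0 contribute to degree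
    0 of the product. *)
Lemma component0_mul (a b : A) : acomp a 0%N = 0 \/ acomp b 0%N = 0 ->
  acomp (a * b) 0%N = 0.
Proof.
move=> ab0.
have [s aE] := sum_component (ga_direct (ga_axioms A)) a.
have [r bE] := sum_component (ga_direct (ga_axioms A)) b.
rewrite {1}aE {1}bE mulr_suml component_sum big1 // => i _.
rewrite mulr_sumr component_sum big1 // => j _.
have ijG : ga_deg (i + j)%N (acomp a i * acomp b j).
  by apply: (ga_mul (ga_axioms A)); exact: component_deg.
rewrite (component_homogeneous _ _ ijG).
case: i j {ijG} => [|i] [|j] //=.
by case: ab0 => ->; rewrite ?mul0r ?mulr0.
Qed.

(** A Nakayama-type argument on the coordinate of [e i] along itself, which is 1. Modulo A_{>=1} it
    equals that of [f (g (e i))], a combination of images under [f] of generators with degrees in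
    [S]. If [dg i] is not in [S], the coordinates of these images have no part of degree 0, and 1 =
    0 follows. *)
Lemma basis_degree (P N : gradedModule A) (S : seq int) (n : nat)
    (dg : 'I_n -> int) (e : 'I_n -> N)
    (f : {linear P -> N}) (g : {linear N -> P}) :
  homogeneous_basis dg e -> generated_in S P -> degree_zero f ->
  (forall x, irrelevant_mul (f (g x) - x)) -> forall i, dg i \in S.
Proof.
move=> eb Pgen f0 fg i; apply: contrapT => /negP iS.
have [c [cP cK]] := basis_coord eb.
have cS m (a : 'I_m -> A) (h : 'I_m -> N) :
    c (\sum_j a j *: h j) 0 i = \sum_j a j * c (h j) 0 i.
  by rewrite linear_sum summxE; apply: eq_bigr => j _; rewrite linearZ mxE.
have ce : c (e i) 0 i = 1.
  have -> : e i = \sum_j (delta_mx 0 i : 'rV[A]_n) 0 j *: e j.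
    rewrite (bigD1 i) //= big1 => [|j /negbTE ji];
      by rewrite mxE ?eqxx ?ji ?andbF ?scale0r // scale1r addr0.
  by rewrite cK mxE !eqxx.
have [m [a [h [ai fgE]]]] := fg (e i).
have [m' [b [h' [h'd gE]]]] := Pgen (g (e i)).
have eE : e i = f (g (e i)) - (f (g (e i)) - e i) by rewrite subKr.
have : acomp (c (e i) 0 i) 0%N = 0.
  rewrite eE linearB !mxE componentB fgE cS component_sum.
  rewrite [X in _ - X]big1 ?subr0 => [|j _]; last first.
    by apply: component0_mul; left; exact: irrelevant_component0.
  rewrite gE linear_sum.
  under eq_bigr do rewrite linearZ.
  rewrite cS component_sum big1 // => j _.
  apply: component0_mul; right; have [l lS h'l] := h'd j.
  have := f0 _ _ h'l; rewrite {1}(cP (f (h' j))) => /(homogeneous_coord eb i).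
  case=> [->|[p [pG pE]]]; first exact: component0.
  rewrite (component_homogeneous _ _ pG); case: p {pG} pE => //.
  by rewrite add0r => lE; rewrite lE lS in iS.
rewrite ce (component_id _ (ga_one (ga_axioms A))) => /eqP.
by rewrite oner_eq0.
Qed.

Lemma minimal_basis_degree (P Q : gradedSequence A) (M : gradedModule A)
    (S : nat -> seq int) :
  minimal_projective_resolution P M -> (forall n, generated_in (S n) (P n)) ->
  minimal_projective_resolution Q M ->
  forall n (r : nat) (dg : 'I_r -> int) (e : 'I_r -> Q n),
    homogeneous_basis dg e -> forall i, dg i \in S n.
Proof.
move=> [[/resolution_augmentation[epsP PP] Pproj] _] Pgen.
move=> [[/resolution_augmentation[epsQ QQ] Qproj] Qmin] n r dg e eb.
have [f [fd fe fE]] := comparison_map PP QQ Pproj.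
have [g [gd ge gE]] := comparison_map QQ PP Qproj.
apply: (basis_degree (f := f n) (g := g n) eb (Pgen n) (fd n)).
pose theta n : {linear Q n -> Q n} := (f n \o g n) \- idfun.
apply: (minimal_endomorphism (theta := theta) QQ) => // [m l x xl|x|m x].
- have [[_ GB _ _] _] := gm_axioms (Q m).
  by apply: GB => //; exact/fd/gd.
- by rewrite linearB fe ge subrr.
- by rewrite /= linearB /= fE gE.
Qed.

End Comparison.

(** * Splitting block triangular differentials *)

Section BlockSplitting.

Context (k : fieldType) (A : gradedAlgebra k).

Section BlockBasis.

Context (N : gradedModule A) (s t : nat) (dg : 'I_(s + t) -> int).
Context (e : 'I_(s + t) -> N).
Hypothesis eb : homogeneous_basis dg e.

Definition left_block : gradedSubmodule N :=
  @span _ _ N s (fun i => dg (lshift t i)) (fun i => e (lshift t i))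
    (fun i => let: And3 edg _ _ := eb in edg (lshift t i)).

Definition right_block : gradedSubmodule N :=
  @span _ _ N t (fun i => dg (rshift s i)) (fun i => e (rshift s i))
    (fun i => let: And3 edg _ _ := eb in edg (rshift s i)).

Lemma sheared_complement (b : 'I_t -> N)
    (bdg : forall i, gm_deg (dg (rshift s i)) (b i)) :
  (forall i, left_block (e (rshift s i) - b i)) ->
  complement left_block (span bdg).
Proof.
move=> Lb; have [_ _ ex] := eb; split=> [x|x [c xE] [c' xE']].
  have [c [xE _]] := ex x; rewrite big_split_ord /= in xE.
  exists (x - \sum_i c 0 (rshift s i) *: b i); last first.
    by rewrite subKr; exists (fun i => c 0 (rshift s i)).
  rewrite xE -addrA -sumrB; apply: gsD; first by exists (fun i => c 0 (lshift t i)).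
  by apply: gs_sum => i; rewrite -scalerBr; exact: gsZ.
have [c1 c1E] : left_block (\sum_i c' i *: e (rshift s i)).
  have -> : \sum_i c' i *: e (rshift s i) =
      \sum_i c' i *: (e (rshift s i) - b i) + x.
    by rewrite xE' -big_split; apply: eq_bigr => i _ /=; rewrite -scalerDr subrK.
  apply: gsD; last by exists c.
  by apply: gs_sum => i; exact: gsZ.
(* Both the zero row and the row (-c1, c') are coordinates of 0, so c' = 0. *)
have [w [_ wU]] := ex 0.
have w0 : w = 0 by apply: wU; rewrite big1 // => i _; rewrite mxE scale0r.
have wc : w = row_mx (- \row_i c1 i) (\row_i c' i).
  apply: wU; rewrite big_split_ord /=.
  under eq_bigr do rewrite row_mxEl !mxE scaleNr.
  under [X in _ + X]eq_bigr do rewrite row_mxEr mxE.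
  by rewrite sumrN c1E addNr.
rewrite xE' big1 // => i _; have := congr1 (fun v : 'rV[A]_(s + t) => v 0 (rshift s i)) wc.
by rewrite w0 row_mxEr !mxE => <-; rewrite scale0r.
Qed.

Lemma block_complement : complement left_block right_block.
Proof. by apply: sheared_complement => i; rewrite subrr; exact: gs0. Qed.

End BlockBasis.

Context (Q : gradedSequence A) (s t : nat -> nat).
Context (dg : forall m, 'I_(s m + t m) -> int).
Context (e : forall m, 'I_(s m + t m) -> Q m).
Hypothesis eb : forall m, homogeneous_basis (@dg m) (@e m).

Notation L m := (left_block (eb m)).
Notation R m := (right_block (eb m)).

(** Coordinate-free form of the block shape. If c is the row of second-block coordinates of x and c
    U = X' F', then adding to the first-block part of x the combination of the first block with
    coefficients X' gives a z whose boundary has the same first-block part as d x. *)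
Lemma block_row_space (m : nat) (F' : 'M[A]_(s m.+1, s m)) (U : 'M[A]_(t m.+1, s m))
    (F'' : 'M[A]_(t m.+1, t m)) :
  matrix_representation (cdiff Q m) (@e m.+1) (@e m) (block_mx F' 0 U F'') ->
  (forall X'' : 'rV[A]_(t m.+1), exists X' : 'rV[A]_(s m.+1), X'' *m U = X' *m F') ->
  (forall x, L m.+1 x -> L m (cdiff Q m x)) /\
  (forall x, exists2 z, L m.+1 z & R m (cdiff Q m x - cdiff Q m z)).
Proof.
move=> rep adm.
have dl i : cdiff Q m (@e m.+1 (lshift _ i)) = \sum_j F' i j *: @e m (lshift _ j).
  rewrite rep big_split_ord /= [X in _ + X]big1 ?addr0 => [|j _].
    by apply: eq_bigr => j _; rewrite block_mxEul.
  by rewrite block_mxEur mxE scale0r.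
have dr i : cdiff Q m (@e m.+1 (rshift _ i)) =
    \sum_j U i j *: @e m (lshift _ j) + \sum_j F'' i j *: @e m (rshift _ j).
  rewrite rep big_split_ord /=; congr (_ + _); apply: eq_bigr => j _.
    by rewrite block_mxEdl.
  by rewrite block_mxEdr.
have mulE p q r (X : 'M[A]_(p, q)) (F : 'M[A]_(q, r)) (v : 'I_r -> Q m) i :
    \sum_l X i l *: (\sum_j F l j *: v j) = \sum_j (X *m F) i j *: v j.
  under eq_bigr do rewrite scaler_sumr.
  rewrite exchange_big; apply: eq_bigr => j _; rewrite mxE scaler_suml.
  by apply: eq_bigr => l _; rewrite scalerA.
split=> [_ [c ->]|x].
  rewrite linear_sum; apply: gs_sum => i; rewrite linearZ; apply: gsZ.
  by rewrite dl; exists (F' i).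
have [ex _] := block_complement (eb m.+1).
have [y Ly [c xyE]] := ex x; have [X' X'E] := adm (\row_i c i).
pose z := \sum_i X' 0 i *: @e m.+1 (lshift _ i).
exists (y + z); first by apply: gsD => //; exists (X' 0).
have dz : cdiff Q m z = \sum_i c i *: (\sum_j U i j *: @e m (lshift _ j)).
  transitivity (\sum_i (\row_i c i) 0 i *: (\sum_j U i j *: @e m (lshift _ j))).
    rewrite mulE X'E -mulE linear_sum; apply: eq_bigr => i _.
    by rewrite linearZ dl.
  by apply: eq_bigr => i _; rewrite mxE.
have -> : cdiff Q m x - cdiff Q m (y + z) = cdiff Q m (x - y) - cdiff Q m z.
  by rewrite [cdiff Q m (y + z)]linearD opprD addrA [cdiff Q m (x - y)]linearB.
rewrite xyE dz linear_sum -sumrB; apply: gs_sum => i.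
rewrite linearZ dr -scalerBr addrC addKr; apply: gsZ.
by exists (F'' i).
Qed.

Hypothesis Lst : forall m x, L m.+1 x -> L m (cdiff Q m x).
Hypothesis boundaryR :
  forall m x, exists2 z, L m.+1 z & R m (cdiff Q m x - cdiff Q m z).

Lemma sheared_stable_complement :
  (forall n, degree_zero (cdiff Q n)) ->
  (forall n x, cdiff Q n x = 0 <-> exists y, x = cdiff Q n.+1 y) ->
  exists (b : forall n, 'I_(t n) -> Q n)
      (bdg : forall n i, gm_deg (dg (rshift (s n) i)) (b n i)),
    (forall n, complement (L n) (span (bdg n))) /\
    stable (fun n => span (bdg n)).
Proof.
move=> d0 exQ.
pose spanned n (b : 'I_(t n) -> Q n) x := exists c : 'I_(t n) -> A, x = \sum_i c i *: b i.
(* The last clause loads the induction: it lets the next shear remove the     *)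
(* [L]-components of the boundaries of the generators.                        *)
pose I n (b : 'I_(t n) -> Q n) :=
  [/\ forall i, gm_deg (dg (rshift (s n) i)) (b i),
      forall i, L n (@e n (rshift (s n) i) - b i)
    & forall x p q, cdiff Q n x = p + q -> L n p -> spanned n b q ->
      exists2 z, L n.+1 z & p = cdiff Q n z].
have boundaryL n x : L n (cdiff Q n x) ->
    exists2 z, L n.+1 z & cdiff Q n x = cdiff Q n z.
  move=> Ldx; have [z Lz Rz] := boundaryR x; exists z => //.
  have [_ uq] := block_complement (eb n); apply/subr0_eq/uq => //.
  by apply: gsB => //; exact: Lst.
have [||b _ bP] := @dependent_choice_family (fun n => 'I_(t n) -> Q n) I
  (fun n b b1 => forall i, spanned n b (cdiff Q n (b1 i)))
  (fun i => @e 0%N (rshift (s 0%N) i)).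
(* In index 0 the basis is not sheared, and [boundaryR] gives the last clause: p - d z lies in both
   blocks. *)
- split=> [i|i|x p q dE Lp Rq]; first by have [] := eb 0.
    by rewrite subrr; exact: gs0.
  have [z Lz Rz] := boundaryR x; exists z => //.
  have [_ uq] := block_complement (eb 0); apply/subr0_eq/uq.
    by apply: gsB => //; exact: Lst.
  have -> : p - cdiff Q 0 z = cdiff Q 0 x - cdiff Q 0 z - q.
    by rewrite dE addrAC addrK.
  exact: gsB.
- move=> n b [bdg Lb bim]; have C := sheared_complement bdg Lb.
  have [pr [pr0 _ prR _]] := complement_proj C.
  have [b1 b1P] : {b1 : 'I_(t n.+1) -> Q n.+1 & forall i,
      [/\ gm_deg (dg (rshift (s n.+1) i)) (b1 i),
          L n.+1 (@e n.+1 (rshift (s n.+1) i) - b1 i)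
        & spanned n b (cdiff Q n (b1 i))]}.
    apply: (@choice _ _ (fun i v => [/\ gm_deg (dg (rshift (s n.+1) i)) v,
      L n.+1 (@e n.+1 (rshift (s n.+1) i) - v) & spanned n b (cdiff Q n v)])) => i.
    set v := @e n.+1 _; have vd : gm_deg (dg (rshift (s n.+1) i)) v by have [] := eb n.+1.
    (* The invariant writes the [L n]-component of d v as d z with z in [L n.+1]; the new generator
       is v minus a version of z homogeneous of the degree of v, so its boundary keeps only the
       sheared component. *)
    have [|z Lz zE] := bim v (gsub_inc (pr (cdiff Q n v)))
      (cdiff Q n v - gsub_inc (pr (cdiff Q n v))) _ (gsub_incP _) (prR _).
      by rewrite addrC subrK.
    have [|z' [Lz' z'd z'E]] :=
        homogeneous_preimage (l := dg (rshift (s n.+1) i)) (d0 n) Lz.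
      by rewrite -zE; apply/gsub_inc_deg/pr0/d0.
    exists (v - z'); split; last by rewrite linearB z'E -zE; exact: prR.
      by have [[_ GB _ _] _] := gm_axioms (Q n.+1); exact: GB.
    by rewrite subKr.
  exists b1; split=> [|i]; last by have [] := b1P i.
  split=> [i|i|x p q dE Lp [c qE]]; [by have [] := b1P i | by have [] := b1P i |].
  (* Applying d to d x = p + q gives d p = - d q, an element of [L n] and of the sheared span, hence
     0. Exactness then makes p a boundary. *)
  have dp0 : cdiff Q n p = 0.
    have [_ uq] := C; apply: uq; first exact: Lst.
    have -> : cdiff Q n p = - cdiff Q n q.
      apply/eqP; rewrite -addr_eq0 -linearD -dE; apply/eqP/exQ; by exists x.
    rewrite -sub0r; apply: gsB; first exact: gs0.
    rewrite qE linear_sum; apply: gs_sum => i; rewrite linearZ; apply: gsZ.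
    by have [] := b1P i.
  by move/exQ: dp0 Lp => [y ->]; exact: boundaryL.
have bdg n i : gm_deg (dg (rshift (s n) i)) (b n i) by have [[]] := bP n.
exists b, bdg; split=> [n|n _ [c ->]].
  by apply: sheared_complement; have [[]] := bP n.
rewrite linear_sum; apply: gs_sum => i; rewrite linearZ; apply: gsZ.
by have [_] := bP n; apply.
Qed.

End BlockSplitting.

(** * Purity of the two blocks *)

(** By monotonicity, a [hi] at position i of the first block confines the degrees [lo] to the
    positions before i, fewer than [s]; a [lo] in the second block makes the whole first block [lo]
    as well, giving at least [s + 1] of them. *)
Lemma sorted_two_values (s t : nat) (dg : 'I_(s + t) -> int) (lo hi : int) :
  lo < hi -> (forall i j : 'I_(s + t), (i <= j)%N -> dg i <= dg j) ->
  (forall i, dg i \in [:: lo; hi]) -> s = #|[set i | dg i == lo]| ->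
  (forall i, dg (lshift t i) = lo) /\ (forall i, dg (rshift s i) = hi).
Proof.
move=> lohi mono dgP sE; set B := [set i | _] in sE; split=> i.
  have := dgP (lshift t i); rewrite !inE => /orP[/eqP //|/eqP hiE].
  have /subset_leq_card : B \subset [set lshift t j | j in [set~ i]].
    apply/subsetP => j; rewrite inE => /eqP loE.
    have ji : (j < i)%N.
      rewrite ltnNge; apply/negP => /(mono (lshift t i) j).
      by rewrite hiE loE leNgt lohi.
    apply/imsetP; exists (Ordinal (ltn_trans ji (ltn_ord i))); last exact: val_inj.
    by rewrite !inE -val_eqE /= ltn_eqF.
  rewrite -sE card_imset; last exact: lshift_inj.
  by rewrite cardsC1 card_ord leqNgt ltn_predL (leq_ltn_trans (leq0n i) (ltn_ord i)).
have := dgP (rshift s i); rewrite !inE => /orP[/eqP loE|/eqP //].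
have /subset_leq_card : rshift s i |: [set lshift t j | j in [set: 'I_s]] \subset B.
  apply/subsetP => j; rewrite !inE => /orP[/eqP ->|/imsetP[l _ ->]]; first exact/eqP.
  have := dgP (lshift t l); rewrite !inE => /orP[//|/eqP hiE].
  have := mono (lshift t l) (rshift s i).
  by rewrite hiE loE leNgt lohi /= => /(_ (ltnW (leq_trans (ltn_ord l) (leq_addr _ _)))).
rewrite -sE cardsU1 card_imset; last exact: lshift_inj.
rewrite cardsT card_ord; case: imsetP => [[j _ /eqP]|_]; first by rewrite eq_rlshift.
by rewrite ltnn.
Qed.

Section Purity.

Context (k : fieldType) (A : gradedAlgebra k).

Lemma decomposable_pure_blocks (d : nat) (Q : gradedSequence A)
    (s t : nat -> nat) (dg : forall m, 'I_(s m + t m) -> int)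
    (e : forall m, 'I_(s m + t m) -> Q m) :
  (forall m, homogeneous_basis (dg m) (e m)) ->
  (forall n i, dg n i \in Delta d n) ->
  (forall n, let m := (3 * n + 2)%N in ~ is_zero (Q m) ->
        s m = #|[set i | dg m i == (2 * n * d + d)%N%:Z]|) ->
  exists alpha beta : nat -> nat,
    (forall n i, dg n (lshift (t n) i) = (alpha n)%:Z) /\
    (forall n i, dg n (rshift (s n) i) = (beta n)%:Z).
Proof.
move=> eb dgD sE.
suff H n : exists ab : nat * nat, (forall i, dg n (lshift (t n) i) = ab.1%:Z) /\
    (forall i, dg n (rshift (s n) i) = ab.2%:Z).
  have [ab abP] := choice H.
  by exists (fun n => (ab n).1), (fun n => (ab n).2); split=> n; have [] := abP n.
have := dgD n; rewrite /Delta; case E: (n %% 3)%N => [|[|r]] dgn.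
- exists ((2 * (n %/ 3) * d)%N, (2 * (n %/ 3) * d)%N).
  by split=> i /=; apply/eqP; rewrite -mem_seq1.
- exists ((2 * (n %/ 3) * d + 1)%N, (2 * (n %/ 3) * d + 1)%N).
  by split=> i /=; apply/eqP; rewrite -mem_seq1.
set m := (n %/ 3)%N in dgn *.
exists ((2 * m * d + d)%N, (2 * m * d + d + 1)%N) => /=.
(* The remainder is [r.+2] and below 3, so [r] is 0. *)
have nE : n = (3 * m + 2)%N.
  rewrite [LHS](divn_eq n 3) mulnC E; congr (_ + _)%N.
  by have := ltn_mod n 3; rewrite E; case: r {E dgn}.
(* The block size is prescribed only for nonzero terms; a zero term has an empty basis, since
   coordinates are unique and 1 differs from 0 in [A]. *)
case: (pselect (is_zero (Q n))) => [Q0|Qn].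
  have none (i : 'I_(s n + t n)) : False.
    have [c [_ cK]] := basis_coord (eb n).
    have := cK (delta_mx 0 i); rewrite [X in c X]Q0 linear0.
    by move/rowP/(_ i)/eqP; rewrite !mxE !eqxx eq_sym oner_eq0.
  by split=> i; case: (none); [exact: lshift i | exact: rshift i].
apply: sorted_two_values => //.
- by rewrite ltz_nat addn1.
- by have [_ mono _] := eb n.
(* The index is generalized because the types of [dg n] and [e n] depend on it, which blocks
   rewriting with [nE]. *)
have sE' n' : n' = (3 * m + 2)%N -> ~ is_zero (Q n') ->
    s n' = #|[set i | dg n' i == (2 * m * d + d)%N%:Z]| by move=> ->; exact: sE.
exact: sE'.
Qed.

Lemma decomposable_blocks (d : nat) (Q : gradedSequence A) : decomposable d Q ->
  exists (s t : nat -> nat) (dg : forall m, 'I_(s m + t m) -> int)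
    (e : forall m, 'I_(s m + t m) -> Q m)
    (eb : forall m, homogeneous_basis (dg m) (e m)),
  [/\ forall m x, left_block (eb m.+1) x -> left_block (eb m) (cdiff Q m x),
      forall m x, exists2 z, left_block (eb m.+1) z
        & right_block (eb m) (cdiff Q m x - cdiff Q m z)
    & forall n, let m := (3 * n + 2)%N in ~ is_zero (Q m) ->
        s m = #|[set i | dg m i == (2 * n * d + d)%N%:Z]| ].
Proof.
move=> [s [t [dg [e [eb F sE]]]]]; exists s, t, dg, e, eb.
suff H m : (forall x, left_block (eb m.+1) x -> left_block (eb m) (cdiff Q m x)) /\
    (forall x, exists2 z, left_block (eb m.+1) z
        & right_block (eb m) (cdiff Q m x - cdiff Q m z)).
  by split=> // m; have [] := H m.
case: (pselect (is_zero (Q m.+1))) => [Q0|/F[F' [U [F'' [rep adm]]]]].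
  by split=> [x _|x]; [|exists x; [|rewrite subrr; exact: gs0]];
    rewrite (Q0 x) ?linear0; exact: gs0.
apply: block_row_space rep _ => X''; case: adm => [[_ _]|[_ _ t0]]; first exact.
(* In the permitted form (F' 0) the second block of rows is empty, so the product with [U] is an
   empty sum. *)
exists 0; rewrite mul0mx; apply/matrixP => i j; rewrite !mxE big1 // => l _.
have : (l < 0)%N by rewrite -[X in (_ < X)%N]t0.
by [].
Qed.

End Purity.

(** * Assembly of the pure resolutions and of the short exact sequence *)

Theorem theorem0p3 (k : fieldType) (A : gradedAlgebra k) (d : nat)
    (M : gradedModule A) (Q : gradedSequence A) :
  (2 <= d)%N -> connected A -> noetherian A ->
  bikoszul_module d M -> minimal_free_resolution Q M -> decomposable d Q ->
  (exists (N' N'' : gradedModule A) (Q' Q'' : gradedSequence A),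
     [/\ projective_resolution Q' N' /\ pure Q',
         projective_resolution Q'' N'' /\ pure Q''
       & sequence_iso Q (sequence_dirsum Q' Q'')]) /\
  (exists (M' M'' : gradedModule A) (f : {linear M' -> M})
          (g : {linear M -> M''}),
     [/\ degree_zero f, degree_zero g, short_exact f g,
         delta_koszul M' & delta_koszul M'']).
Proof.
move=> _ _ _ [_ [P [Pmin Pgen]]] [Qres Qfree Qmin].
move=> /decomposable_blocks[s [t [dg [e [eb [Lst LR sE]]]]]].
have Qproj n : graded_projective (Q n) by exact: basis_projective (eb n).
have dgD n i : dg n i \in Delta d n.
  exact: (minimal_basis_degree Pmin Pgen _ (eb n)).
have [alpha [beta [dgL dgR]]] := decomposable_pure_blocks eb dgD sE.
have [eps [d0 eps0 epss ex0 exQ]] := resolution_augmentation Qres.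
have [b [bdg [LC Rst]]] := sheared_stable_complement Lst LR d0 exQ.
have CL n := complementC (LC n).
(* Stated for any complementary pair of stable families, because it is applied in both orders: once
   to the first blocks and once to the sheared second blocks. *)
have minres P1 R1 (st1 : stable P1) (st2 : stable R1) :
    (forall n, complement (P1 n) (R1 n)) ->
    minimal_projective_resolution (subsequence st1) (gsub (graded_image (P1 0%N) eps0)).
  move=> PR; split; last exact: summand_minimal PR Qmin.
  split; last by move=> n; exact: summand_projective (PR n) (Qproj n).
  exact: (summand_resolution st1 st2 PR).
have minL := minres _ _ Lst Rst LC; have minR := minres _ _ Rst Lst CL.
have genL m : generated_in [:: (alpha m)%:Z] (subsequence Lst m).
  apply: (gsub_generated (b := fun i => e m (lshift (t m) i))) => // i.
  split; first exact: span_gen.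
  by rewrite -(dgL m i); have [] := eb m.
have genR m : generated_in [:: (beta m)%:Z] (subsequence Rst m).
  apply: (gsub_generated (b := b m)) => // i.
  by split; [exact: span_gen | rewrite -(dgR m i)].
split.
  exists (gsub (graded_image (left_block (eb 0)) eps0)), (gsub (graded_image (span (bdg 0)) eps0)).
  exists (subsequence Lst), (subsequence Rst); split.
  - by split; [have [] := minL | move=> n; exists (alpha n)%:Z].
  - by split; [have [] := minR | move=> n; exists (beta n)%:Z].
  - exact: summands_iso.
have [f [g [f0 g0 fg]]] := complement_short_exact
  (image_complement Lst Rst LC eps0 ex0 epss).
exists (gsub (graded_image (left_block (eb 0)) eps0)), (gsub (graded_image (span (bdg 0)) eps0)), f, g.
split=> //.
  by exists alpha, (subsequence Lst).
by exists beta, (subsequence Rst).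
Qed.
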